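(* Let $R$ be a commutative finite chain ring of nilpotency index $e$ and residue field $\mathbb{F}_q$, and let $n$ be a positive integer. If the maximal ideal of $R$ is generated by $\gamma$, then $$d_n(R,\gamma^s)=\frac{q^n-1}{q-1}\,q^{en^2-n-e+1}\prod_{i=1}^{n-1} (1-q^{-s-i})$$ for all integers $s$ with $1\leq s<e$.
   Context: A commutative finite chain ring is a finite commutative ring with identity $1\neq 0$ whose ideals are linearly ordered by inclusion. Such a ring $R$ has a unique maximal ideal, which is principal; if $\gamma$ is a generator of it, the nilpotency index of $R$ is the smallest positive integer $e$ with $\gamma^e=0$. The residue field of $R$ is the finite field $R/\gamma R$; it is $\mathbb{F}_q$, where $q$ is a prime power. For a commutative ring $S$ and $a\in S$, $d_n(S,a)$ denotes the number of $n\times n$ matrices over $S$ whose determinant is $a$. An empty product equals $1$. *)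

(* Defs.v *)
From mathcomp Require Import all_boot all_order all_algebra.

Set Implicit Arguments.
Unset Strict Implicit.
Unset Printing Implicit Defensive.

Import GRing.Theory.
Local Open Scope ring_scope.

(* Unlike idealr_closed of ring_quotient, the whole ring counts as an ideal.  *)
Definition is_ideal (R : finComNzRingType) (I : {set R}) : Prop :=
  [/\ 0 \in I,
      forall x y, x \in I -> y \in I -> x + y \in I
    & forall a x, x \in I -> a * x \in I].

Definition finite_chain_ring (R : finComNzRingType) : Prop :=
  forall I J : {set R}, is_ideal I -> is_ideal J -> (I \subset J) || (J \subset I).

Definition maximal_ideal (R : finComNzRingType) (M : {set R}) : Prop :=
  [/\ is_ideal M, M != [set: R]
    & forall I : {set R}, is_ideal I -> M \subset I -> I = M \/ I = [set: R]].

Definition principal_ideal (R : finComNzRingType) (g : R) : {set R} :=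
  [set g * x | x : R].

Definition nilpotency_index (R : finComNzRingType) (g : R) (e : nat) : Prop :=
  [/\ (0 < e)%N, g ^+ e = 0
    & forall k : nat, (0 < k)%N -> g ^+ k = 0 -> (e <= k)%N].

(* F, with the projection pi, is the quotient R / I up to isomorphism:        *)
(* pi is a surjective ring morphism with kernel I.                            *)
Definition quotient_map (R : finComNzRingType) (I : {set R})
    (F : finFieldType) (pi : {rmorphism R -> F}) : Prop :=
  (forall y : F, exists x : R, pi x = y) /\
  (forall x : R, pi x = 0 <-> x \in I).

Definition det_count (n : nat) (S : finComNzRingType) (a : S) : nat :=
  #|[set A : 'M[S]_n | \det A == a]|.

(* Main.v *)
Require Import Defs.
From mathcomp Require Import all_boot all_order all_algebra perm.
From mathcomp Require Import ring.

Set Implicit Arguments.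
Unset Strict Implicit.
Unset Printing Implicit Defensive.

Import Order.TTheory GRing.Theory Num.Theory.
Local Open Scope ring_scope.

(** Write q for the order of the residue field, so that |R| = q^e, and d_n(s) for
    the number of n x n matrices with determinant g^s, where 0 <= s < e.  The
    count is governed by a two-term recursion, obtained by sorting matrices of
    size m+1 (with m >= 1) according to their first column.

    If the first column c has a unit entry, c is the first column of some
    invertible matrix; multiplying by its inverse turns c into the first basis
    vector, and what is left is a free row of length m and an m x m minor whose
    determinant is a unit multiple of g^s.  As rescaling one row by a unit
    permutes the matrices, associated determinants are equally frequent, and
    such a column is completed in q^(e m) d_m(s) ways ([card_completions]).

    If the first column lies in gR^(m+1), it is g c for exactly q^(m+1) columns
    c, because the annihilator of g has q elements.  Replacing g c by c divides
    the determinant by g, which determines it only up to the annihilator of g: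
    it may be any of the q elements g^(s-1) + x with g x = 0.  For s < e all of
    them are associates of g^(s-1), hence the number of these matrices is
    q^(-m) d_(m+1)(s-1) ([det_count_residue0_exp]), and there are none for
    s = 0.

    Since there are q^(e(m+1)) (1 - q^(-m-1)) columns with a unit entry, the
    closed form follows by induction on m and then on s from the Pascal-like
    identity [det_product_rec] for P_m(s) = prod_(1 <= i <= m) (1 - q^(-s-i)).
    The formula also holds for s = 0, where it counts matrices with determinant
    1, and this is where the inner induction starts. *)

(** * Fibres of additive maps *)

(** All fibres of an additive map over its image are translates of the kernel. *)
Lemma card_preim_additive (V W : finZmodType) (f : V -> W) (S : {set W}) :
    {morph f : x y / x - y} -> S \subset f @: [set: V] ->
  #|f @^-1: S| = (#|S| * #|f @^-1: [set 0%R]|)%N.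
Proof.
move=> fB sSf; rewrite -sum1_card (partition_big f (mem S)); last first.
  by move=> x; rewrite inE.
rewrite -sum_nat_const; apply: eq_bigr => y Sy.
have /imsetP[x0 _ def_y] := subsetP sSf y Sy.
rewrite sum1_card -(card_imset _ (addIr (- x0))).
apply: eq_card => z; rewrite !inE; apply/imsetP/eqP => [[x]|fz0].
  by move=> /andP[_ /eqP fx] ->; rewrite fB fx def_y subrr.
have fx : f (z + x0) = y.
  by rewrite -[LHS](subrK (f x0)) -fB addrK fz0 add0r.
exists (z + x0); last by rewrite addrK.
by apply/andP; rewrite inE fx.
Qed.

Lemma card_columns (T : finType) (S : {set T}) n :
  #|[set c : 'cV[T]_n | [forall i, c i ord0 \in S]]| = (#|S| ^ n)%N.
Proof.
rewrite -[n in RHS]card_ord -card_ffun_on.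
have colK : cancel (fun f : {ffun 'I_n -> T} => \col_i f i)
                   (fun c : 'cV[T]_n => [ffun i => c i ord0]).
  by move=> f; apply/ffunP=> i; rewrite ffunE mxE.
rewrite -(card_imset _ (can_inj colK)); apply: eq_card => c; rewrite inE.
apply/forallP/imsetP => [cS | [f /ffun_onP fS ->] i]; last by rewrite mxE.
exists [ffun i => c i ord0]; first by apply/ffun_onP=> i; rewrite ffunE.
by apply/colP=> i; rewrite mxE ffunE.
Qed.

(** * Annihilators in the chain ring *)

Section ResidueField.

Context (R : finComNzRingType) (g : R) (e : nat) (F : finFieldType).
Context (pi : {rmorphism R -> F}).
Hypothesis g_nil : nilpotency_index g e.
Hypothesis pi_quo : quotient_map (principal_ideal g) pi.

Local Notation q := #|F|.
Local Notation ann x := (( *%R x) @^-1: [set 0 : R]).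

Lemma residue_eq0P x : reflect (exists y, x = g * y) (pi x == 0).
Proof.
apply: (iffP eqP) => [/(proj2 pi_quo) /imsetP[y _ ->] | [y ->]]; first by exists y.
by apply/(proj2 pi_quo)/imsetP; exists y.
Qed.

Lemma residue_gen : pi g = 0.
Proof. by apply/eqP/residue_eq0P; exists 1; rewrite mulr1. Qed.

(** An element of the maximal ideal is nilpotent, so the inverse of [1 + x] is
    a finite geometric series. *)
Lemma unit_1D x : pi x = 0 -> exists v, v * (1 + x) = 1.
Proof.
move=> /eqP/residue_eq0P[y ->].
exists (\sum_(i < e) (- (g * y)) ^+ i).
have [_ ge0 _] := g_nil.
have := subrX1 (- (g * y)) e.
rewrite exprNn exprMn ge0 mul0r mulr0 sub0r => h.
by apply: oppr_inj; rewrite h; ring.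
Qed.

Lemma residue_unit x : pi x != 0 -> exists v, v * x = 1.
Proof.
move=> px; have [y py] := proj1 pi_quo (pi x)^-1.
have [|v vxy] := @unit_1D (y * x - 1).
  by rewrite rmorphB rmorphM rmorph1 /= py mulVf ?subrr.
by exists (v * y); rewrite -vxy; ring.
Qed.

Lemma gen_exp_neq0 k : (k < e)%N -> g ^+ k != 0.
Proof.
have [_ _ mine] := g_nil.
case: k => [|k] lt_ke; first by rewrite expr0 oner_neq0.
by apply/eqP => gk0; have := mine k.+1 isT gk0; rewrite leqNgt lt_ke.
Qed.

(** Dividing by [g] as long as possible must stop before [g ^+ e = 0]. *)
Lemma gen_decomp x : x != 0 -> exists k u, (k < e)%N /\ x = g ^+ k * u /\ pi u != 0.
Proof.
have [e_gt0 ge0 _] := g_nil => x0.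
suff H k : (exists y, x = g ^+ k * y) \/
    exists k u, (k < e)%N /\ x = g ^+ k * u /\ pi u != 0.
  have [[y xy]|//] := H e; by rewrite xy ge0 mul0r eqxx in x0.
elim: k => [|k [[y xy]|]]; [by left; exists x; rewrite mul1r | | by right].
have [/residue_eq0P[z yz]|pu] := boolP (pi y == 0).
  by left; exists z; rewrite xy yz exprSr mulrA.
right; exists k, y; split=> //; rewrite ltnNge; apply: contra x0 => le_ek.
by rewrite xy -(subnK le_ek) exprD ge0 mulr0 mul0r.
Qed.

(** The annihilator of [g] is generated by [g ^+ e.-1]: in the form
    [g ^+ j * u] with [u] a unit, an element killed by [g] has [j.+1 >= e]. *)
Lemma ann_gen x k : g * x = 0 -> (k < e)%N -> exists y, x = g ^+ k * y.
Proof.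
have [-> _ _|x0 gx0 lt_ke] := eqVneq x 0; first by exists 0; rewrite mulr0.
have [j [u [_ [xu /residue_unit[v vu]]]]] := gen_decomp x0.
have le_kj : (k <= j)%N.
  have : ~~ (j.+1 < e)%N.
    apply/negP => /gen_exp_neq0/eqP; apply.
    by rewrite -[LHS]mulr1 -vu mulrCA exprS -(mulrA g) -xu gx0 mulr0.
  by rewrite -leqNgt => /(leq_trans lt_ke); rewrite ltnS.
by exists (g ^+ (j - k) * u); rewrite mulrA -exprD subnKC.
Qed.

Lemma card_residue : #|R| = (q * #|[set x | pi x == 0%R]|)%N.
Proof.
rewrite -cardsT -(preimsetT pi) card_preim_additive.
- by rewrite cardsT; congr muln; apply: eq_card => x; rewrite !inE.
- exact: rmorphB.
by apply/subsetP=> y _; have [x <-] := proj1 pi_quo y; apply: imset_f.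
Qed.

(** Multiplication by [g] maps [R] onto the maximal ideal, whose index is
    [q], so its kernel has [q] elements. *)
Lemma card_ann_gen : #|ann g| = q.
Proof.
have R0 : (0 < #|[set x | pi x == 0%R]|)%N.
  by apply/card_gt0P; exists 0; rewrite inE rmorph0.
apply/eqP; rewrite -(eqn_pmul2l R0) [X in _ == X]mulnC -card_residue.
rewrite -card_preim_additive; last 2 first.
- exact: mulrBr.
- by apply/subsetP=> x; rewrite inE => /residue_eq0P[y ->]; apply: imset_f.
apply/eqP; rewrite -cardsT; apply: eq_card => x; rewrite !inE.
by apply/residue_eq0P; exists x.
Qed.

(** The preimage of [ann g] under multiplication by [g ^+ k] is
    [ann (g ^+ k.+1)], and all of [ann g] is reached because it lies in the
    ideal generated by [g ^+ k]. *)
Lemma card_ann_exp k : (k <= e)%N -> #|ann (g ^+ k)| = (q ^ k)%N.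
Proof.
elim: k => [_|k IHk lt_ke].
  rewrite expn0 -(cards1 (0 : R)); apply: eq_card => x.
  by rewrite !inE mul1r.
rewrite expnS -(IHk (ltnW lt_ke)) -[X in (X * _)%N]card_ann_gen.
rewrite -card_preim_additive.
- by apply: eq_card => x; rewrite !inE exprS -mulrA.
- exact: mulrBr.
apply/subsetP=> x; rewrite !inE => /eqP gx0.
by have [y ->] := ann_gen gx0 lt_ke; apply: imset_f.
Qed.

Lemma card_ring : #|R| = (q ^ e)%N.
Proof.
rewrite -(card_ann_exp (leqnn e)) -cardsT; have [_ -> _] := g_nil.
by apply: eq_card => x; rewrite !inE mul0r eqxx.
Qed.

(** Cancelling one factor [g] in an equation of determinants leaves an error
    term in [ann g]; this error does not change the class up to associates. *)
Lemma ann_gen_associate x s : g * x = 0 -> (s.+1 < e)%N ->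
  exists u v, v * u = 1 /\ g ^+ s + x = u * g ^+ s.
Proof.
move=> gx0 lt_se; have [y ->] := ann_gen gx0 lt_se.
have [v vu] : exists v, v * (1 + g * y) = 1.
  by apply: unit_1D; rewrite rmorphM /= residue_gen mul0r.
by exists (1 + g * y), v; split=> //; rewrite exprS; ring.
Qed.

End ResidueField.

(** * Completing the first column *)

Section FirstColumn.

Context (R : finComNzRingType).

Lemma mulmx_adj_inverse n (H : 'M[R]_n) v :
  v * \det H = 1 -> H *m (v *: \adj H) = 1%:M.
Proof.
by move=> vH; rewrite -scalemxAr mul_mx_adj -mul_scalar_mx -scalar_mxM vH.
Qed.

Lemma det_count_mulmx n (H : 'M[R]_n) v a : v * \det H = 1 ->
  det_count n (\det H * a) = det_count n a.
Proof.
move=> vH; have HV := mulmx_adj_inverse vH; have VH := mulmx1C HV.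
have mulHK : cancel (mulmx H : 'M_n -> 'M_n) (mulmx (v *: \adj H)).
  by move=> A; rewrite mulmxA VH mul1mx.
rewrite /det_count -[RHS](card_imset _ (can_inj mulHK)).
apply: eq_card => A; rewrite inE; apply/eqP/imsetP => [dA | [B]].
  exists (v *: \adj H *m A); last by rewrite mulmxA HV mul1mx.
  rewrite inE; apply/eqP; rewrite det_mulmx dA mulrA -det_mulmx VH.
  by rewrite det1 mul1r.
by rewrite inE => /eqP <- ->; rewrite det_mulmx.
Qed.

(** The size is positive because the unit is absorbed by scaling one row. *)
Lemma det_count_associate n u v (a : R) : v * u = 1 ->
  det_count n.+1 (u * a) = det_count n.+1 a.
Proof.
move=> vu; pose H := block_mx u%:M 0 0 1%:M : 'M[R]_(1 + n).
have dH : \det H = u by rewrite det_ublock det1 det_scalar1 mulr1.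
by rewrite -{1}dH (@det_count_mulmx _ H v) // dH.
Qed.

Lemma card_det_first_column m (P : pred R) :
  #|[set A : 'M[R]_m.+1 | P (\det A)]| =
    (\sum_(c : 'cV[R]_(1 + m))
       #|[set B : 'M[R]_(1 + m, m) | P (\det (row_mx c B : 'M_(1 + m)))]|)%N.
Proof.
rewrite -sum1_card.
rewrite (reindex (fun p : 'cV[R]_(1 + m) * 'M[R]_(1 + m, m) =>
                    row_mx p.1 p.2)) /=; last first.
  exists (fun A => (lsubmx A, rsubmx A)) => [[c B]|A] _ /=.
    by rewrite row_mxKl row_mxKr.
  by rewrite hsubmxK.
under [RHS]eq_bigr do rewrite -sum1_card.
rewrite pair_big_dep; apply: eq_bigl => -[c B] /=.
by rewrite !inE.
Qed.

(** After a row exchange the unit entry comes first, and the column can be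
    completed by the columns of the identity matrix. *)
Lemma completable_column m (c : 'cV[R]_(1 + m)) i v : v * c i ord0 = 1 ->
  exists2 H : 'M[R]_(1 + m),
    c = H *m col_mx 1%:M 0 & exists w, w * \det H = 1.
Proof.
move=> vc; pose d := xrow i ord0 c.
pose H := block_mx (usubmx d) 0 (dsubmx d) 1%:M : 'M[R]_(1 + m).
have dE : d = H *m col_mx 1%:M 0.
  by rewrite mul_block_col !mulmx1 !mul0mx !mulmx0 !addr0 vsubmxK.
have dH : \det H = c i ord0.
  rewrite det_lblock det1 mulr1 det_mx11 !mxE.
  rewrite (_ : lshift m 0 = ord0 :> 'I_(1 + m)); last exact: val_inj.
  by rewrite tpermR.
exists (tperm_mx i ord0 *m H).
  by rewrite -mulmxA -dE /d xrowE mulmxA -perm_mxM tperm2 perm_mx1 mul1mx.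
exists ((-1) ^+ tperm i ord0 * v).
by rewrite det_mulmx det_perm dH mulrACA vc mulr1 -expr2 sqrr_sign.
Qed.

(** Left multiplication by the inverse of a completion [H] of [c] makes [c] the
    first basis vector; the rest of the matrix then consists of an arbitrary row
    [r] above a square block [M] with [\det H * \det M = a]. *)
Lemma card_completions m (c : 'cV[R]_(1 + m.+1)) i v a : v * c i ord0 = 1 ->
  #|[set B : 'M[R]_(1 + m.+1, m.+1) | \det (row_mx c B : 'M_(1 + m.+1)) == a]|
    = (#|R| ^ m.+1 * det_count m.+1 a)%N.
Proof.
move=> /completable_column[H -> [w wH]].
have HV := mulmx_adj_inverse wH; have VH := mulmx1C HV.
rewrite -sum1_card.
rewrite (reindex (fun p : 'rV[R]_m.+1 * 'M[R]_m.+1 =>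
                    H *m col_mx p.1 p.2)) /=; last first.
  pose V := w *: \adj H.
  exists (fun B => (usubmx (V *m B), dsubmx (V *m B))) => [[r M]|B] _ /=.
    by rewrite mulmxA VH mul1mx col_mxKu col_mxKd.
  by rewrite vsubmxK mulmxA HV mul1mx.
transitivity (\sum_(r : 'rV[R]_m.+1) det_count m.+1 (w * a)%R)%N; last first.
  rewrite sum_nat_const card_mx mul1n -(det_count_associate m (w * a) wH).
  by rewrite mulrA [_ * w]mulrC wH mul1r.
under [RHS]eq_bigr do rewrite /det_count -sum1_card.
rewrite pair_big_dep; apply: eq_bigl => -[r M]; rewrite !inE /=.
rewrite -mul_mx_row det_mulmx -block_mxEh det_ublock det1 mul1r.
apply/eqP/eqP => [<- | ->]; first by rewrite mulrA wH mul1r.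
by rewrite mulrA [_ * w]mulrC wH mul1r.
Qed.

End FirstColumn.

(** * The recursion *)

Section ColumnRecursion.

Context (R : finComNzRingType) (g : R) (e : nat) (F : finFieldType).
Context (pi : {rmorphism R -> F}).
Hypothesis g_nil : nilpotency_index g e.
Hypothesis pi_quo : quotient_map (principal_ideal g) pi.

Local Notation q := #|F|.

Definition residue0 n (c : 'cV[R]_n) : bool :=
  [forall i, c i ord0 \in [set x | pi x == 0]].

Definition det_count_residue0 m (a : R) : nat :=
  \sum_(c : 'cV[R]_(1 + m) | residue0 c)
     #|[set B : 'M[R]_(1 + m, m) | \det (row_mx c B : 'M_(1 + m)) == a]|.

Lemma det_count_split m (a : R) :
  det_count m.+2 a =
    (#|[set c : 'cV[R]_(1 + m.+1) | ~~ residue0 c]|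
       * (#|R| ^ m.+1 * det_count m.+1 a) + det_count_residue0 m.+1 a)%N.
Proof.
rewrite /det_count (card_det_first_column _ (pred1 a)).
rewrite (bigID (@residue0 _)) [LHS]addnC /=.
congr addn; rewrite -sum_nat_const; apply: eq_big => [c|c]; first by rewrite inE.
rewrite negb_forall /= => /existsP[i]; rewrite inE => /(residue_unit g_nil pi_quo).
by case=> v; apply: card_completions.
Qed.

Lemma card_unit_columns n :
  (#|[set c : 'cV[R]_n | ~~ residue0 c]| + #|[set x | pi x == 0%R]| ^ n
     = #|R| ^ n)%N.
Proof.
rewrite -card_columns addnC -[n in RHS]muln1 -(card_mx R n 1).
rewrite -(cardsC [set c : 'cV[R]_n | residue0 c]).
by congr addn; apply: eq_card => c; rewrite !inE.
Qed.

Lemma residue0P n (c : 'cV[R]_n) : reflect (exists d, c = g *: d) (residue0 c).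
Proof.
apply: (iffP forallP) => [c0 | [d ->] i]; last first.
  by rewrite inE; apply/(residue_eq0P pi_quo); exists (d i ord0); rewrite mxE.
have /fin_all_exists[d cd] i : exists y, c i ord0 = g * y.
  by apply/(residue_eq0P pi_quo); have := c0 i; rewrite inE.
by exists (\col_i d i); apply/colP => i; rewrite !mxE cd.
Qed.

Lemma det_scale_column m (c : 'cV[R]_(1 + m)) B :
  \det (row_mx (g *: c) B : 'M_(1 + m)) = g * \det (row_mx c B : 'M_(1 + m)).
Proof.
have -> : row_mx (g *: c) B = row_mx c B *m block_mx g%:M 0 0 1%:M.
  by rewrite mul_row_block !mulmx0 addr0 add0r mulmx1 mul_mx_scalar.
by rewrite det_mulmx det_ublock det1 det_scalar1 mulr1 mulrC.
Qed.

(** The fibres of [c |-> g *: c] over its image, which consists of the columns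
    with entries in the maximal ideal, are translates of the columns with
    entries in the annihilator of [g]. *)
Lemma sum_scaled_columns n (f : 'cV[R]_n -> nat) :
  (\sum_(c : 'cV[R]_n) f (g *: c) = q ^ n * \sum_(c | residue0 c) f c)%N.
Proof.
rewrite (partition_big (fun c => g *: c) (@residue0 n)) /=; last first.
  by move=> c _; apply/residue0P; exists c.
rewrite big_distrr; apply: eq_bigr => c /residue0P[c0 cE].
under eq_bigr => d /eqP -> do [].
rewrite sum_nat_const; congr (_ * _)%N.
transitivity #|( *:%R g) @^-1: [set c]|; first by apply: eq_card => d; rewrite !inE.
rewrite card_preim_additive.
- rewrite cards1 mul1n -(card_ann_gen pi_quo) -card_columns.
  apply: eq_card => d; rewrite !inE.
  apply/eqP/forallP => [gd i|gd].
    by move/colP/(_ i): gd; rewrite !inE !mxE => ->.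
  by apply/colP=> i; have := gd i; rewrite !inE !mxE => /eqP.
- exact: scalerBr.
by apply/subsetP=> d /set1P ->; rewrite cE imset_f.
Qed.

(** The solutions [x] of [g * x = g ^+ s.+1] form the coset [g ^+ s + ann g],
    which has [q] elements, all of them associates of [g ^+ s]. *)
Lemma card_det_scaled s n : (s.+1 < e)%N ->
  #|[set A : 'M[R]_n.+1 | g * \det A == g ^+ s.+1]|
    = (q * det_count n.+1 (g ^+ s)%R)%N.
Proof.
move=> lt_se; rewrite -sum1_card.
pose T := [set x : R | g * x == g ^+ s.+1].
rewrite (partition_big (fun A : 'M_n.+1 => \det A) (mem T)) /=; last first.
  by move=> A; rewrite !inE.
have -> : q = #|T|.
  rewrite -(card_ann_gen pi_quo) -(card_imset _ (addIr (g ^+ s))).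
  apply: eq_card => x; rewrite inE; apply/imsetP/eqP => [[y]|gx].
    by rewrite !inE => /eqP gy ->; rewrite mulrDr gy add0r exprS.
  exists (x - g ^+ s); last by rewrite subrK.
  by rewrite !inE mulrBr gx -exprS subrr.
rewrite -sum_nat_const; apply: eq_bigr => x; rewrite inE => /eqP gx.
have gx0 : g * (x - g ^+ s) = 0 by rewrite mulrBr gx -exprS subrr.
have [u [v [vu]]] := ann_gen_associate g_nil pi_quo gx0 lt_se.
rewrite addrC subrK => xE; rewrite -(det_count_associate n _ vu) -xE.
rewrite sum1_card; apply: eq_card => A; rewrite !inE /= unfold_in /= inE.
by apply: andb_idl => /eqP ->; rewrite gx.
Qed.

(** Both sides, multiplied by [q], count the matrices [A] of size [m.+1] with
    [g * \det A = g ^+ s.+1]: here the factor [g] is moved into the first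
    column. *)
Lemma det_count_residue0_exp m s : (s.+1 < e)%N ->
  (q ^ m * det_count_residue0 m (g ^+ s.+1)%R = det_count m.+1 (g ^+ s)%R)%N.
Proof.
move=> lt_se; have q_gt0 : (0 < q)%N by apply/card_gt0P; exists 0.
apply/eqP; rewrite -(eqn_pmul2l q_gt0) mulnA -expnS -card_det_scaled //.
rewrite -sum_scaled_columns; apply/eqP.
rewrite (card_det_first_column _ (fun x => g * x == g ^+ s.+1)).
by apply: eq_bigr => c _; apply: eq_card => B; rewrite !inE det_scale_column.
Qed.

Lemma det_count_residue0_unit m : det_count_residue0 m 1 = 0%N.
Proof.
apply: big1 => c /residue0P[d ->]; apply: eq_card0 => B; rewrite inE.
rewrite det_scale_column; apply/eqP => /(congr1 pi)/eqP.
by rewrite rmorphM (residue_gen pi_quo) mul0r rmorph1 eq_sym oner_eq0.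
Qed.

End ColumnRecursion.

(** * The closed form *)

Section ClosedForm.

Context (q : rat).
Hypothesis q_gt1 : 1 < q.

Definition det_product (m s : nat) : rat :=
  \prod_(i < m) (1 - q^-1 ^+ (s + i.+1)).

(** Both products on the right contain [det_product m s.+1]; the identity
    reduces to [(1 - y) + y * (1 - z) = 1 - y * z] for [y = q^-1 ^+ m.+1] and
    [z = q^-1 ^+ s.+1]. *)
Lemma det_product_rec m s :
  det_product m.+1 s.+1 =
    (1 - q^-1 ^+ m.+1) * det_product m s.+1 + q^-1 ^+ m.+1 * det_product m.+1 s.
Proof.
have -> : det_product m.+1 s = (1 - q^-1 ^+ s.+1) * det_product m s.+1.
  rewrite /det_product big_ord_recl addn1; congr (_ * _).
  by apply: eq_bigr => i _; rewrite /bump /= addnS.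
rewrite /det_product big_ord_recr /= [in LHS]exprD.
by move: (\prod_(i < m) _) (q^-1 ^+ s.+1) (q^-1 ^+ m.+1) => a b c; ring.
Qed.

Definition det_factor (e m : nat) : rat :=
  (q ^+ m.+1 - 1) / (q - 1) * ((q ^+ e) ^+ (m.+1 ^ 2) / (q ^+ m * q ^+ e)).

(** On the left, the first two factors give the number of columns of length
    [m.+2] with a unit entry, and [(q ^+ e) ^+ m.+1] the number of free rows. *)
Lemma det_factor_rec e m :
  (q ^+ e) ^+ m.+2 * (1 - q^-1 ^+ m.+2) * ((q ^+ e) ^+ m.+1 * det_factor e m) =
    det_factor e m.+1 * (1 - q^-1 ^+ m.+1).
Proof.
have q0 : q != 0 by apply: lt0r_neq0; apply: lt_trans q_gt1.
have q10 : q - 1 != 0 by rewrite subr_eq0 gt_eqF.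
have y0 : q ^+ m != 0 by rewrite expf_neq0.
have Q0 : q ^+ e != 0 by rewrite expf_neq0.
rewrite /det_factor (_ : m.+2 ^ 2 = m.+2 + m.+1 + m.+1 ^ 2)%N; last first.
  by rewrite -!mulnn; ring.
rewrite !exprD !exprVn !(exprS q); move: ((q ^+ e) ^+ (m.+1 ^ 2)) => Z.
move: (q ^+ e) (q ^+ m) Q0 y0 => Q y Q0 y0.
by field; rewrite Q0 y0 q0 q10.
Qed.

End ClosedForm.

Lemma det_count1 (R : finComNzRingType) (a : R) : det_count 1 a = 1%N.
Proof.
apply/eqP/cards1P; exists a%:M; apply/setP => A; rewrite !inE.
rewrite [A]mx11_scalar det_scalar1; apply/eqP/eqP => [->//|/matrixP/(_ 0 0)].
by rewrite !mxE.
Qed.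

(** The case [s = 0] is included since it starts the induction on [s]. *)
Theorem det_count_closed_form (R : finComNzRingType) (g : R) (e : nat)
    (F : finFieldType) (pi : {rmorphism R -> F}) :
  nilpotency_index g e -> quotient_map (principal_ideal g) pi ->
  forall m s : nat, (s < e)%N ->
    (det_count m.+1 (g ^+ s))%:R =
      det_factor #|F|%:R e m * det_product #|F|%:R m s.
Proof.
move=> g_nil pi_quo; set q : rat := #|F|%:R.
have q_gt1 : 1 < q 
  by rewrite ltr1n; apply/card_gt1P; exists 0, 1; rewrite eq_sym oner_eq0.
have q0 : q != 0 by apply: lt0r_neq0; apply: lt_trans q_gt1.
have q10 : q - 1 != 0 by rewrite subr_eq0 gt_eqF.
have ringE : #|R|%:R = q ^+ e by rewrite (card_ring g_nil pi_quo) natrX.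
have maxE : #|[set x | pi x == 0]|%:R = q ^+ e * q^-1.
  apply: (mulfI q0); rewrite -natrM -(card_residue pi_quo) ringE.
  by rewrite mulrCA divff // mulr1.
have colE n : #|[set c : 'cV[R]_n | ~~ residue0 pi c]|%:R =
    (q ^+ e) ^+ n * (1 - q^-1 ^+ n).
  have /(congr1 (fun k => k%:R : rat)) := card_unit_columns pi n.
  rewrite natrD !natrX ringE maxE exprMn => /(canRL (addrK _)) ->.
  by rewrite mulrBr mulr1.
elim=> [|m IHm] s lt_se.
  rewrite det_count1 /det_product big_ord0 mulr1 /det_factor.
  by rewrite !expr1 divff // mul1r mul1r divff // expf_neq0.
elim: s lt_se => [|s IHs] lt_se.
  rewrite (det_count_split g_nil pi_quo) (det_count_residue0_unit pi_quo) addn0.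
  rewrite !natrM natrX colE ringE IHm // [(q ^+ e) ^+ m.+1 * _]mulrA mulrA.
  rewrite det_factor_rec // -mulrA; congr (_ * _).
  by rewrite /det_product big_ord_recr /= add0n mulrC.
have resE : (det_count_residue0 pi m.+1 (g ^+ s.+1))%:R =
    q^-1 ^+ m.+1 * (det_count m.+2 (g ^+ s))%:R.
  rewrite -(det_count_residue0_exp g_nil pi_quo) // natrM natrX mulrA -exprMn.
  by rewrite mulVf // expr1n mul1r.
rewrite (det_count_split g_nil pi_quo) natrD resE (IHs (ltnW lt_se)).
rewrite !natrM natrX colE ringE IHm // det_product_rec.
rewrite [(q ^+ e) ^+ m.+1 * _]mulrA mulrA det_factor_rec //.
by move: (q^-1 ^+ m.+1) => xm; ring.
Qed.

Theorem theorem3p11 (R : finComNzRingType) (gamma : R) (e : nat)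
    (F : finFieldType) (pi : {rmorphism R -> F}) (q n : nat)
    (hR : finite_chain_ring R)
    (hgamma : maximal_ideal (principal_ideal gamma))
    (he : nilpotency_index gamma e)
    (hpi : quotient_map (principal_ideal gamma) pi)
    (hq : #|F| = q)
    (hn : (0 < n)%N) :
  forall s : nat, (1 <= s < e)%N ->
    (det_count n (gamma ^+ s))%:R =
      (q%:R ^+ n - 1) / (q%:R - 1)
      * q%:R ^ (e%:Z * n%:Z ^+ 2 - n%:Z - e%:Z + 1)
      * \prod_(1 <= i < n) (1 - q%:R ^ (- s%:Z - i%:Z)) :> rat.
Proof.
case: n hn => // m _ s /andP[_ lt_se].
have q0 : q%:R != 0 :> rat.
  by rewrite -hq pnatr_eq0 -lt0n; apply/card_gt0P; exists 0.
rewrite (det_count_closed_form he hpi) // hq; congr (_ * _ * _).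
  rewrite (_ : _ + 1 = (e * m.+1 ^ 2)%:Z - (m + e)%:Z); last first.
    by rewrite -mulnn !PoszM PoszD intS; ring.
  by rewrite expfzDr // -exprnN -exprnP exprM exprD.
rewrite /det_product big_add1 big_mkord; apply: eq_bigr => i _.
by rewrite -opprD -PoszD -exprnN exprVn.
Qed.
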